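(* Let $\alpha,\beta\ge0$ be constants, let $\psi$ be a smooth real-valued function of $(x,t)$ on $\Omega\times[a,b]$, and put $p=\partial_t\psi$. Then $\psi$ satisfies the Westervelt equation $$\partial_{tt}\psi-\Delta\psi=\alpha\,\Delta(\partial_t\psi)+\beta\,\partial_t\big((\partial_t\psi)^2\big)\quad\text{on }\Omega\times[a,b]$$ if and only if $(\psi,p)$ satisfies the system $$(1-2\beta p)\,\partial_t p-\alpha\,\Delta\partial_t\psi=\Delta\psi,$$ $$-(1-2\beta p)\,\partial_t\psi=-(1-2\beta p)\,p$$ on $\Omega\times[a,b]$.
   Context: $\Omega\subset\mathbb{R}^d$ is a bounded domain, $[a,b]$ a time interval, and $\Delta$ is the Laplacian in the space variable $x$. Equations are understood pointwise. *)

(* Defs.v *)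
From HB Require Import structures.
From mathcomp Require Import all_boot all_order all_algebra.
From mathcomp Require Import all_classical all_reals all_analysis.

Set Implicit Arguments.
Unset Strict Implicit.
Unset Printing Implicit Defensive.

Import Order.TTheory GRing.Theory Num.Theory.
Import numFieldNormedType.Exports.

Local Open Scope classical_set_scope.
Local Open Scope ring_scope.

(* Functions of (x, t) are total functions 'rV[R]_d -> R -> R.  All notions
   below, evaluated at points of Omega x [a, b] with Omega open, depend only on
   the values taken on Omega x [a, b]. *)

Definition bounded_domain (R : realType) (d : nat) (Omega : set 'rV[R]_d) : Prop :=
  [/\ open Omega, connected Omega, Omega !=set0 & bounded_set Omega].

Definition partial_x (R : realType) (d : nat) (i : 'I_d)
    (f : 'rV[R]_d -> R -> R) : 'rV[R]_d -> R -> R :=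
  fun x t => 'D_(delta_mx 0 i) (fun y => f y t : R^o) x.

Definition laplacian (R : realType) (d : nat)
    (f : 'rV[R]_d -> R -> R) : 'rV[R]_d -> R -> R :=
  fun x t => \sum_(i < d) partial_x i (partial_x i f) x t.

(* The difference quotient as s -> t with s <> t and s in [a, b]: the usual
   two-sided derivative at interior times, the one-sided one at a and at b. *)
Definition time_quotient (R : realType) (d : nat) (a b : R)
    (f : 'rV[R]_d -> R -> R) (x : 'rV[R]_d) (t : R) : set_system R :=
  (f x s - f x t) / (s - t) @[s --> within `[a, b] t^'].

Definition derivable_t (R : realType) (d : nat) (a b : R)
    (f : 'rV[R]_d -> R -> R) (x : 'rV[R]_d) (t : R) : Prop :=
  cvg (time_quotient a b f x t).

Definition partial_t (R : realType) (d : nat) (a b : R)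
    (f : 'rV[R]_d -> R -> R) : 'rV[R]_d -> R -> R :=
  fun x t => lim (time_quotient a b f x t).

(* C^k on Omega x [a, b], up to the end times: all iterated partial
   derivatives of order at most k, in any order of differentiation, exist at
   every point of Omega x [a, b] and are continuous on it. *)
Fixpoint Ck_on (R : realType) (d : nat) (Omega : set 'rV[R]_d) (a b : R)
    (k : nat) (f : 'rV[R]_d -> R -> R) : Prop :=
  {within Omega `*` `[a, b], continuous (fun z : 'rV[R]_d * R => f z.1 z.2)} /\
  match k with
  | 0%N => True
  | k'.+1 =>
      [/\ forall (i : 'I_d) (x : 'rV[R]_d) (t : R),
            Omega x -> a <= t <= b ->
            derivable (fun y => f y t : R^o) x (delta_mx 0 i),
          forall (x : 'rV[R]_d) (t : R),
            Omega x -> a <= t <= b -> derivable_t a b f x t,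
          forall i : 'I_d, Ck_on Omega a b k' (partial_x i f)
        & Ck_on Omega a b k' (partial_t a b f)]
  end.

Definition smooth_on (R : realType) (d : nat) (Omega : set 'rV[R]_d) (a b : R)
    (f : 'rV[R]_d -> R -> R) : Prop :=
  forall k : nat, Ck_on Omega a b k f.

Definition westervelt (R : realType) (d : nat) (Omega : set 'rV[R]_d)
    (a b alpha beta : R) (psi : 'rV[R]_d -> R -> R) : Prop :=
  forall (x : 'rV[R]_d) (t : R), Omega x -> a <= t <= b ->
    partial_t a b (partial_t a b psi) x t - laplacian psi x t =
    alpha * laplacian (partial_t a b psi) x t
      + beta * partial_t a b (fun y s => (partial_t a b psi y s) ^+ 2) x t.

Definition westervelt_system (R : realType) (d : nat) (Omega : set 'rV[R]_d)
    (a b alpha beta : R) (psi p : 'rV[R]_d -> R -> R) : Prop :=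
  forall (x : 'rV[R]_d) (t : R), Omega x -> a <= t <= b ->
    (1 - 2 * beta * p x t) * partial_t a b p x t
        - alpha * laplacian (partial_t a b psi) x t
      = laplacian psi x t /\
    - (1 - 2 * beta * p x t) * partial_t a b psi x t
      = - (1 - 2 * beta * p x t) * p x t.

(* Main.v *)
Require Import Defs.
From HB Require Import structures.
From mathcomp Require Import all_boot all_order all_algebra.
From mathcomp Require Import all_classical all_reals all_analysis.
From mathcomp Require Import ring lra.
Import Order.TTheory GRing.Theory Num.Theory.
Import numFieldNormedType.Exports.
Local Open Scope classical_set_scope.
Local Open Scope ring_scope.

(** Once [p] is the time derivative of [psi], the second equation of the system is an identity, and
    the first is the Westervelt equation rearranged through $\partial_t((\partial_t\psi)^2) =
    2\,\partial_t\psi\,\partial_{tt}\psi$. The analytic content is this chain rule ([partial_t_sqr])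
    for a derivative that is one-sided at [a] and [b]. Since [p] is tied to [psi] only on Omega x
    [a, b], [partial_t_congr] transfers time derivatives. *)

(** Properness makes limits along this filter unique, so that [lim] can be computed. It holds
    because [a < b] leaves room on at least one side of [t]. *)
Lemma within_itv_dnbhs_proper (R : realType) (a b t : R) :
  a < b -> a <= t <= b -> ProperFilter (within `[a, b] t^').
Proof.
move=> ab /andP[ta tb]; apply: Build_ProperFilter_ex => P.
rewrite /within /= => -[e /= e0 Pe].
(* Move right by [e / 2], truncated at [b], when [t < b]; otherwise [t = b], and move left,
   truncated at [a]. *)
have [tltb|] := ltP t b.
- pose s := Num.min b (t + e / 2).
  have ts : t < s by rewrite lt_min tltb /=; lra.
  have sb : s <= b by rewrite ge_min lexx.
  have se : s <= t + e / 2 by rewrite ge_min lexx orbT.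
  exists s; apply: (Pe s).
  + by rewrite /= ltr0_norm; lra.
  + by rewrite gt_eqF.
  + by rewrite /= in_itv /=; apply/andP; split; lra.
- move=> bt; pose s := Num.max a (t - e / 2).
  have st : s < t by rewrite gt_max; apply/andP; split; lra.
  have sa : a <= s by rewrite le_max lexx.
  have se : t - e / 2 <= s by rewrite le_max lexx orbT.
  exists s; apply: (Pe s).
  + by rewrite /= gtr0_norm; lra.
  + by rewrite lt_eqF.
  + by rewrite /= in_itv /=; apply/andP; split; lra.
Qed.

Lemma partial_t_congr (R : realType) (d : nat) (a b : R)
    (f g : 'rV[R]_d -> R -> R) (x : 'rV[R]_d) (t : R) :
  a <= t <= b -> (forall s, a <= s <= b -> f x s = g x s) ->
  partial_t a b f x t = partial_t a b g x t.
Proof.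
move=> tab fg; rewrite /partial_t; congr lim.
(* The hypothesis is symmetric in the two functions, so one inclusion of filters gives both. *)
have sub h k : (forall s, a <= s <= b -> h x s = k x s) ->
    time_quotient a b h x t `<=` time_quotient a b k x t.
  move=> hk P; rewrite /time_quotient /= /within /=.
  apply: (@filterS _ t^') => s Ps sab; have := Ps sab.
  by rewrite /preimage /= (hk t tab) (hk s) //; move: sab; rewrite /= in_itv.
by apply/seteqP; split; apply: sub => // s sab; rewrite fg.
Qed.

Lemma partial_t_sqr (R : realType) (d : nat) (a b : R)
    (f : 'rV[R]_d -> R -> R) (x : 'rV[R]_d) (t : R) :
  a < b -> a <= t <= b -> derivable_t a b f x t ->
  partial_t a b (fun y s => f y s ^+ 2) x t
    = 2 * f x t * partial_t a b f x t.
Proof.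
move=> ab tab; rewrite /derivable_t /partial_t /time_quotient => df.
have PF := within_itv_dnbhs_proper _ _ _ _ ab tab.
set F := within _ _ in df PF *; set l := (X in _ = _ * X).
have neqt : \forall s \near F, s != t.
  by rewrite /F /within /=; apply: filterS (nbhs_dnbhs_neq t) => s.
have cid : s @[s --> F] --> t.
  by apply: cvg_within_filter; exact: nbhs_dnbhs.
have cf : f x s @[s --> F] --> f x t.
  (* Differentiability gives continuity: for [s != t] this expression is [f x s], and its last
     factor tends to 0. *)
  have : f x t + (f x s - f x t) / (s - t) * (s - t) @[s --> F]
           --> f x t + l * (t - t).
    apply: cvgD; [exact: cvg_cst|apply: cvgM; [exact: df|]].
    by apply: cvgB; [exact: cid|exact: cvg_cst].
  rewrite subrr mulr0 addr0 => ft; apply: cvg_trans ft; apply: near_eq_cvg.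
  by apply: filterS neqt => s st /=; rewrite divfK ?subr_eq0// addrC subrK.
have -> : 2 * f x t * l = (f x t + f x t) * l by ring.
(* The quotient of the square, factored as a difference of squares. *)
have cfl : (f x s + f x t) * ((f x s - f x t) / (s - t)) @[s --> F]
             --> (f x t + f x t) * l.
  by apply: cvgM; [apply: cvgD; [exact: cf|exact: cvg_cst]|exact: df].
apply/cvg_lim => //; apply: cvg_trans cfl; apply: near_eq_cvg.
by apply: nearW => s /=; rewrite mulrA; congr (_ / _); ring.
Qed.

Theorem lemma1 (R : realType) (d : nat) (Omega : set 'rV[R]_d)
    (a b alpha beta : R) (psi p : 'rV[R]_d -> R -> R)
    (hOmega : bounded_domain Omega) (hab : a < b)
    (halpha : 0 <= alpha) (hbeta : 0 <= beta)
    (hpsi : smooth_on Omega a b psi)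
    (hp : forall (x : 'rV[R]_d) (t : R),
        Omega x -> a <= t <= b -> p x t = partial_t a b psi x t) :
  westervelt Omega a b alpha beta psi <->
  westervelt_system Omega a b alpha beta psi p.
Proof.
(* Order 2 is enough: it yields the time differentiability of [partial_t a b psi], which the chain
   rule needs. *)
have [_ [_ _ _ [_ [_ dpsit _ _]]]] := hpsi 2%N.
have ptE x t : Omega x -> a <= t <= b ->
    partial_t a b p x t = partial_t a b (partial_t a b psi) x t.
  by move=> Ox tab; apply: partial_t_congr => // s; exact: hp.
have sqrE x t : Omega x -> a <= t <= b ->
    partial_t a b (fun y s => (partial_t a b psi y s) ^+ 2) x t
      = 2 * partial_t a b psi x t * partial_t a b (partial_t a b psi) x t.
  by move=> Ox tab; apply: partial_t_sqr => //; exact: dpsit.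
(* After these rewrites only a linear rearrangement remains, with the products of derivatives as
   atoms. *)
split=> W x t Ox tab; have := W x t Ox tab; rewrite ptE// sqrE// hp//.
- by move=> E; split=> //; lra.
- by case=> E _; lra.
Qed.
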